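(* Let $\mathfrak{B}$ be the structure with domain $V(\mathbb{C}_3)$ in the signature consisting of the $16$ elements of the relation algebra $56_{65}$, defined by: $(x,y)\in N^{\mathfrak{B}}$ iff $x\ne y$ and $xy\notin E(\overline{\mathbb{C}_3})$; $(x,y)\in 0^{\mathfrak{B}}$ (resp. $1^{\mathfrak{B}}$) iff $x\neq y$, $xy\in E(\overline{\mathbb{C}_3})$ and $\sigma_{\overline{\mathbb{C}_3}}(xy)=0$ (resp. $=1$); $\mathrm{id}^{\mathfrak{B}}$ is equality; and each element $a$ (a set of atoms) is interpreted as the union of the interpretations of the atoms in $a$. Then $\mathfrak{B}$ pp-constructs $K_3$.
   Context: The graph $\mathbb{C}_3$ has as vertices the unit complex numbers with rational argument (range of $\arg$ is $(-\pi,\pi]$), two distinct vertices $z,w$ being adjacent iff $|\arg(z/w)|>\frac{2}{3}\pi$; $\overline{\mathbb{C}_3}$ is its complement. The relation algebra $56_{65}$ has atoms $\mathrm{id},N,0,1$ and its elements are all subsets of the set of atoms. A labelling $\sigma\colon E\to\mathbb{Z}_2$ is anti-even-balancing if every induced cycle $C$ has $\sum_{e\in E(C)}\sigma(e)=0$ if $|V(C)|=3$ and $=1$ otherwise. The labelling $\sigma_{\overline{\mathbb{C}_3}}$ is defined from fixed data: a partition $V(\overline{\mathbb{C}_3})=C_0\cup C_1$ into two disjoint subsets each dense in the unit circle, with $i(x)$ such that $x\in C_{i(x)}$; a set $P=\{p^0,\dots,p^4\}$ of vertices inducing a $5$-cycle in $\overline{\mathbb{C}_3}$ with $p^jp^{j+1}$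 edges (indices mod $5$); for each vertex $x$, $p_x:=p^j$ for the smallest $j$ with $xp^j\in E(\overline{\mathbb{C}_3})$; $T$ is the spanning tree with edges $\{xp_x\}$, $\sigma_T(xp_x)=i(x)$, and $\sigma_{\overline{\mathbb{C}_3}}$ is the unique anti-even-balancing labelling of $\overline{\mathbb{C}_3}$ extending $\sigma_T$. $K_3$ is the complete graph on three vertices (as a structure with one symmetric binary edge relation). A structure $\mathfrak{A}$ pp-constructs $\mathfrak{D}$ if $\mathfrak{D}$ is homomorphically equivalent to a pp-power of $\mathfrak{A}$, where a pp-power of $\mathfrak{A}$ is a structure with domain $A^n$ for some $n\ge1$ each of whose $k$-ary relations, viewed as a $kn$-ary relation on $A$, is primitive-positive definable in $\mathfrak{A}$. *)

(* Defs.v *)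
From HB Require Import structures.
From mathcomp Require Import all_boot all_order all_algebra.
From mathcomp Require Import complex.
From mathcomp Require Import all_classical reals topology normedtype trigo.

Set Implicit Arguments.
Unset Strict Implicit.
Unset Printing Implicit Defensive.

Import Order.TTheory GRing.Theory Num.Theory numFieldNormedType.Exports.

Local Open Scope classical_set_scope.
Local Open Scope ring_scope.
Local Open Scope complex_scope.

Record signature := Signature { symbol :> Type; arity : symbol -> nat }.

(* A structure is given by the interpretations of its symbols over a domain A;
   a k-tuple over A is a function 'I_k -> A. *)
Definition structure (S : signature) (A : Type) : Type :=
  forall r : S, ('I_(arity r) -> A) -> Prop.

(* X is the type of variables. *)
Inductive atomic_formula (S : signature) (X : Type) : Type :=
| AEq of X & X
| ARel (r : S) of ('I_(arity r) -> X).

Arguments AEq {S X}.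
Arguments ARel {S X}.

(* exists y_0 ... y_(m-1), (conjunction of atomic formulas), where m = pp_bound,
   with free variables in X. *)
Record pp_formula (S : signature) (X : Type) := PPFormula {
  pp_bound : nat;
  pp_atoms : seq (atomic_formula S (X + 'I_pp_bound)) }.

Definition atomic_holds (S : signature) (A X : Type) (M : structure S A)
    (v : X -> A) (a : atomic_formula S X) : Prop :=
  match a with
  | AEq x y => v x = v y
  | ARel r t => M r (fun i => v (t i))
  end.

Definition pp_holds (S : signature) (A X : Type) (M : structure S A)
    (v : X -> A) (f : pp_formula S X) : Prop :=
  exists w : 'I_(pp_bound f) -> A,
    let u x := match x with inl i => v i | inr j => w j end in
    foldr (fun a P => atomic_holds M u a /\ P) True (pp_atoms f).

Definition pp_definable (S : signature) (A X : Type) (M : structure S A)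
    (P : (X -> A) -> Prop) : Prop :=
  exists f : pp_formula S X, forall v : X -> A, P v <-> pp_holds M v f.

(* A k-ary relation on 'I_n -> A is viewed as a kn-ary relation on A, whose
   coordinates are indexed by 'I_k * 'I_n. *)
Definition pp_power (S T : signature) (A : Type) (M : structure S A) (n : nat)
    (N : structure T ('I_n -> A)) : Prop :=
  (1 <= n)%N /\
  forall r : T, pp_definable M
    (fun v : 'I_(arity r) * 'I_n -> A => N r (fun i j => v (i, j))).

Definition homomorphism (T : signature) (A B : Type) (M : structure T A)
    (N : structure T B) (f : A -> B) : Prop :=
  forall (r : T) (v : 'I_(arity r) -> A), M r v -> N r (fun i => f (v i)).

Definition hom_equivalent (T : signature) (A B : Type) (M : structure T A)
    (N : structure T B) : Prop :=
  (exists f : A -> B, homomorphism M N f) /\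
  (exists g : B -> A, homomorphism N M g).

Definition pp_constructs (S T : signature) (A D : Type) (M : structure S A)
    (N : structure T D) : Prop :=
  exists (n : nat) (L : structure T ('I_n -> A)),
    pp_power M L /\ hom_equivalent L N.

Definition graph_sig : signature := @Signature unit (fun _ => 2%N).

Definition K3 : structure graph_sig 'I_3 := fun _ v => v ord0 <> v ord_max.

Section Graphs.
Variables (V : Type) (E : V -> V -> Prop).

Definition induced_cycle (n : nat) (c : 'I_n -> V) : Prop :=
  [/\ (3 <= n)%N, injective c &
      forall k l : 'I_n, E (c k) (c l) <-> l = ordS k \/ k = ordS l].

(* A labelling of the (undirected) edges is a function of the two endpoints
   which is symmetric on edges; its values off E are irrelevant. *)
Definition edge_labelling (sigma : V -> V -> 'Z_2) : Prop :=
  forall x y, E x y -> sigma x y = sigma y x.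

Definition anti_even_balancing (sigma : V -> V -> 'Z_2) : Prop :=
  forall (n : nat) (c : 'I_n -> V), induced_cycle c ->
    \sum_(k < n) sigma (c k) (c (ordS k)) = if n == 3%N then 0 else 1.

Definition least_neighbour (n : nat) (p : 'I_n -> V) (x : V) (j : 'I_n) : Prop :=
  E x (p j) /\ forall k : 'I_n, (k < j)%N -> ~ E x (p k).

End Graphs.

Section Circle.
Variable R : realType.

(* The principal argument, in ]-pi, pi]. *)
Definition arg (z : R[i]) : R :=
  xget 0 [set t : R | - pi < t <= pi /\ z = `|z| * (cos t +i* sin t)].

Definition unit_rational_arg (z : R[i]) : bool :=
  (`|z| == 1) && `[< exists q : rat, arg z = ratr q >].

Definition C3_vertex := {z : R[i] | unit_rational_arg z}.

Definition C3_edge (z w : C3_vertex) : Prop :=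
  z <> w /\ `|arg (val z / val w)| > 2 / 3 * pi.

Definition C3c_edge (z w : C3_vertex) : Prop := z <> w /\ ~ C3_edge z w.

(* R[i]^o is R[i] with the topology induced by its norm. *)
Definition dense_in_circle (D : set C3_vertex) : Prop :=
  [set z : R[i] | `|z| = 1] `<=` closure (val @` D : set R[i]^o).

(* The conditions defining the labelling, for a partition C, index function i
   and 5-cycle p. Since p^0 and p^1 are each other's least neighbours, the last
   condition forces i (p^0) = i (p^1), which is what makes sigma_T well
   defined. *)
Definition is_sigma_C3c (C : 'Z_2 -> set C3_vertex) (i : C3_vertex -> 'Z_2)
    (p : 'I_5 -> C3_vertex) (sigma : C3_vertex -> C3_vertex -> 'Z_2) : Prop :=
  [/\ [/\ trivIset setT C, \bigcup_k C k = setT &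
          forall k, dense_in_circle (C k)],
      forall x, C (i x) x,
      induced_cycle C3c_edge p &
      [/\ edge_labelling C3c_edge sigma,
          anti_even_balancing C3c_edge sigma &
          forall x j, least_neighbour C3c_edge p x j -> sigma x (p j) = i x]].

End Circle.

Inductive atom := At_id | At_N | At_0 | At_1.

Definition ord_of_atom (a : atom) : 'I_4 :=
  match a with
  | At_id => inord 0 | At_N => inord 1 | At_0 => inord 2 | At_1 => inord 3
  end.

Definition atom_of_ord (k : 'I_4) : atom :=
  match val k with 0 => At_id | 1 => At_N | 2 => At_0 | _ => At_1 end.

Lemma ord_of_atomK : cancel ord_of_atom atom_of_ord.
Proof. by case; rewrite /atom_of_ord /= inordK. Qed.

HB.instance Definition _ := Equality.copy atom (can_type ord_of_atomK).
HB.instance Definition _ := Choice.copy atom (can_type ord_of_atomK).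
HB.instance Definition _ := Countable.copy atom (can_type ord_of_atomK).
HB.instance Definition _ := Finite.copy atom (can_type ord_of_atomK).

(* The elements of the relation algebra 56_65, as binary relation symbols. *)
Definition sig56_65 : signature := @Signature {set atom} (fun _ => 2%N).

Definition atom_rel (R : realType)
    (sigma : C3_vertex R -> C3_vertex R -> 'Z_2) (a : atom)
    (x y : C3_vertex R) : Prop :=
  match a with
  | At_id => x = y
  | At_N => x <> y /\ ~ C3c_edge x y
  | At_0 => [/\ x <> y, C3c_edge x y & sigma x y = 0]
  | At_1 => [/\ x <> y, C3c_edge x y & sigma x y = 1]
  end.

Definition structB (R : realType)
    (sigma : C3_vertex R -> C3_vertex R -> 'Z_2) :
    structure sig56_65 (C3_vertex R) :=
  fun (s : {set atom}) v =>
    exists2 a : atom, a \in s & atom_rel sigma a (v ord0) (v ord_max).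

Lemma card_sig56_65 : #|{set atom}| = 16%N.
Proof.
have : #|{: atom}| = #|'I_4|.
  apply: (@bij_eq_card _ _ ord_of_atom); exists atom_of_ord.
    exact: ord_of_atomK.
  by case=> [[|[|[|[|k]]]] ?] //; apply/val_inj; rewrite /= inordK.
by rewrite card_ord => h; rewrite -cardsT -powersetT card_powerset cardsT h.
Qed.

Section ArgTheory.
Variable R : realType.
Implicit Types (z : R[i]) (t : R).

Let on_circle z : z != 0 ->
  exists a b : R, a ^+ 2 + b ^+ 2 = 1 /\ z = `|z| * (a +i* b).
Proof.
move=> z0; have nz0 : `|z| != 0 by rewrite normr_eq0.
have : `|z / `|z| | = 1 by rewrite normf_div normr_id divff.
have zE : z = `|z| * (z / `|z|) by rewrite mulrC mulfVK.
move: (z / `|z|) zE => [a b] zE.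
move=> nE; exists a, b; split => //; move: nE; rewrite normc_def => -[h].
have h0 : 0 <= a ^+ 2 + b ^+ 2 by rewrite addr_ge0// sqr_ge0.
by rewrite -(sqr_sqrtr h0) h expr1n.
Qed.

Let sin_lt0 t : - pi < t < 0 -> sin t < 0.
Proof.
move=> /andP[h1 h2]; rewrite -oppr_gt0 -sinN sin_gt0_pi//.
by rewrite oppr_gt0 h2 ltrNl.
Qed.

Lemma arg_spec z :
  - pi < arg z <= pi /\ z = `|z| * (cos (arg z) +i* sin (arg z)).
Proof.
rewrite /arg; apply: (xgetPex 0 (P := [set t : R |
  - pi < t <= pi /\ z = `|z| * (cos t +i* sin t)])).
have [->|/on_circle[a [b [ab zE]]]] := eqVneq z 0.
  by exists 0; rewrite /= normr0 mul0r oppr_lt0 pi_gt0 pi_ge0.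
have a1 : -1 <= a <= 1.
  by rewrite -ler_norml -(expr_le1 (n := 2)) // real_normK ?num_real // -ab
     lerDl sqr_ge0.
have bE : 1 - a ^+ 2 = b ^+ 2 by rewrite -ab addrAC subrr add0r.
have [b0|b0] := leP 0 b.
  have pac : - pi < acos a.
    by apply: (@lt_le_trans _ _ 0); rewrite ?acos_ge0 // oppr_lt0 pi_gt0.
  exists (acos a) => /=; rewrite acos_lepi // pac.
  by rewrite acosK ?in_itv //= sin_acos // bE sqrtr_sqr (ger0_norm b0).
exists (- acos a) => /=; rewrite cosN sinN acosK ?in_itv //=.
rewrite sin_acos // bE sqrtr_sqr (ltr0_norm b0) opprK; split => //.
rewrite ltrN2 (@le_trans _ _ 0) ?oppr_le0 ?acos_ge0 ?pi_ge0 // andbT acos_ltpi //.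
case/andP: a1 => a1 ->; rewrite andbT lt_neqAle a1 andbT.
apply: contra_ltN b0 => /eqP aE; move: ab; rewrite -aE sqrrN expr1n.
by move/eqP; rewrite addrC -subr_eq0 addrK sqrf_eq0 => /eqP->.
Qed.

Lemma arg_unique z t : z != 0 -> - pi < t <= pi ->
  z = `|z| * (cos t +i* sin t) -> arg z = t.
Proof.
move=> z0; have [sitv szE] := arg_spec z; move: (arg z) sitv szE => s.
move=> /andP[s1 s2] zs /andP[t1 t2] zt.
have nz0 : `|z| != 0 by rewrite normr_eq0.
have [cE sE] : cos s = cos t /\ sin s = sin t.
  by have := mulfI nz0 (etrans (esym zs) zt) => -[].
have [s0|s0] := leP 0 s; have [t0|t0] := leP 0 t.
- by rewrite -(cosK (x := s)) ?in_itv /= ?s0 // cE cosK // in_itv /= t0.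
- have := sin_ge0_pi (x := s); rewrite s0 s2 sE => /(_ isT).
  by rewrite leNgt sin_lt0 // t1 t0.
- have := sin_ge0_pi (x := t); rewrite t0 t2 -sE => /(_ isT).
  by rewrite leNgt sin_lt0 // s1 s0.
- apply: oppr_inj; rewrite -cosKN ?(ltW s1) ?ltW // cE cosKN //.
  by rewrite (ltW t1) ltW.
Qed.

End ArgTheory.

(* Main.v *)
Require Import Defs.
From mathcomp Require Import all_boot all_order all_algebra.
From mathcomp Require Import complex.
From mathcomp Require Import all_classical reals.
From mathcomp Require Import topology normedtype trigo ring lra.

(* For points of the unit circle, |arg (z/w)| > 2 pi/3 means |z - w|^2 > 3, and
   |x + y + z|^2 >= 0 shows that no three vertices are pairwise N-related. Fix a
   vertex w and read off a bit sigma(x, w) from each neighbour x of w. Triangles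
   have label sum 0, so two neighbours of w joined by an edge labelled 1 have
   different bits; hence three neighbours of w that are pairwise related by
   N or 1 do not all have the same bit. This not-all-equal constraint is
   primitive positive in w, and with one argument of bit 1 it becomes NAND.

   Take tuples (w, x_1, x_2, x_3), joining two tuples with the same w when the
   bits of each tuple are not all equal and the k-th bits are never both 1: the
   position of a bit 1 is a 3-colouring. A triangle comes from one-hot tuples
   with w = p^0, using only two vertices near i w and two near -i w, one of each
   bit: opposite ones are N-related, so all the constraints hold. *)

Set Implicit Arguments.
Unset Strict Implicit.
Unset Printing Implicit Defensive.

Import Order.TTheory GRing.Theory Num.Theory numFieldNormedType.Exports.
Import Normc.

Local Open Scope ring_scope.
Local Open Scope complex_scope.

(** * Chord lengths on the unit circle *)

Section Circle.
Local Open Scope classical_set_scope.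
Variable R : realType.
Implicit Types (u v : R[i]) (x y z : C3_vertex R).

(** With c = cos (pi/3), doubling the angle and reflecting it in pi/2 give 2c^2 - 1 = -c, whose only
    positive root is 1/2. *)
Lemma cos_2pi3 : cos (2 / 3 * pi) = - (1 / 2) :> R.
Proof.
have pi0 : 0 < pi :> R := pi_gt0 R.
have E1 : cos (2 / 3 * pi : R) = cos (pi / 3) ^+ 2 *+ 2 - 1.
  by rewrite -cos_mulr2n; congr cos; field.
have E2 : cos (2 / 3 * pi : R) = - cos (pi / 3).
  have -> : 2 / 3 * pi = - (pi / 3) + pi :> R by field.
  by rewrite cosDpi cosN.
have c0 : 0 < cos (pi / 3 : R) by apply: cos_gt0_pihalf; apply/andP; split; lra.
have : (cos (pi / 3 : R) * 2 - 1) * (cos (pi / 3 : R) + 1) = 0.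
  by move: E1; rewrite E2; lra.
by move/eqP; rewrite mulf_eq0 => /orP[]/eqP; lra.
Qed.

Lemma normc_sqr u : normc u ^+ 2 = complex.Re u ^+ 2 + complex.Im u ^+ 2.
Proof. by case: u => a b /=; rewrite sqr_sqrtr// addr_ge0 ?sqr_ge0. Qed.

Lemma ler_normcD u v : normc (u + v) <= normc u + normc v.
Proof. exact: le_normcD. Qed.

Lemma normc_ge0 u : 0 <= normc u.
Proof. by case: u => a b; apply: sqrtr_ge0. Qed.

Lemma vertex_sqr x : complex.Re (val x) ^+ 2 + complex.Im (val x) ^+ 2 = 1.
Proof.
case: x => u /= /andP[/eqP h _].
by rewrite -normc_sqr; case: h => ->; rewrite expr1n.
Qed.

Lemma normc_vertex x : normc (val x) = 1.
Proof. by case: x => u /= /andP[/eqP[]]. Qed.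

(** The squared chord is 2 - 2 cos t, where t = arg (x/y), and cos is even and decreases on
    [0, pi]. *)
Lemma C3_edgeE x y : C3_edge x y <-> 3 < normc (val x - val y) ^+ 2.
Proof.
set t := arg (val x / val y).
have pi0 : 0 < pi :> R := pi_gt0 R.
have y0 : val y != 0.
  apply/eqP => y0; have := normc_vertex y; rewrite y0 normc0.
  by move=> /esym/eqP; rewrite oner_eq0.
have xyE : val x = (cos t +i* sin t) * val y.
  have [_ h] := arg_spec (val x / val y).
  have n1 : `|val x / val y| = 1.
    rewrite normf_div; case: (x) (y) => [u /= /andP[/eqP-> _]].
    by move=> [v /= /andP[/eqP-> _]]; rewrite divr1.
  by rewrite -[LHS](mulfVK y0) {1}h n1 mul1r.
have dE : normc (val x - val y) ^+ 2 = 2 - 2 * cos t.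
  have -> : val x - val y = ((cos t - 1) +i* sin t) * val y.
    rewrite {1}xyE -[X in _ - X]mul1r -mulrBl; congr (_ * _).
    by apply/eqP; rewrite eq_complex /= subr0 !eqxx.
  rewrite normcM normc_vertex mulr1 normc_sqr /=.
  by have := cos2Dsin2 t; lra.
have [/andP[t1 t2] _] := arg_spec (val x / val y); rewrite -/t in t1 t2.
have tN : `|t| <= pi by rewrite ler_norml t2 (ltW t1).
have key : (2 / 3 * pi < `|t|) = (cos t < - (1 / 2)).
  rewrite -(cos_norm t) -cos_2pi3 ltr_cos ?in_itv //=;
    last by rewrite normr_ge0.
  by apply/andP; split; lra.
rewrite /C3_edge -/t key dE; split=> [[_]|h]; first lra.
split; last lra.
move=> xy; move: dE; rewrite xy subrr normc0 expr0n /=; lra.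
Qed.

(** The three squared distances sum to 9 - |x + y + z|^2, so they cannot all exceed 3. *)
Lemma C3_triangle_free x y z :
  C3_edge x y -> C3_edge y z -> C3_edge z x -> False.
Proof.
move=> /C3_edgeE + /C3_edgeE + /C3_edgeE; rewrite !normc_sqr.
have := vertex_sqr x; have := vertex_sqr y; have := vertex_sqr z.
case: (val x) (val y) (val z) => [a a'] [b b'] [c c'] /=.
have := sqr_ge0 (a + b + c); have := sqr_ge0 (a' + b' + c').
lra.
Qed.

Lemma dense_near (D : set (C3_vertex R)) u (e : R) :
  dense_in_circle D -> normc u = 1 -> 0 < e ->
  exists2 x, D x & normc (u - val x) < e.
Proof.
move=> hD u1 e0.
have : closure (val @` D : set R[i]^o) u.
  by apply: hD; rewrite /= normc_def; case: u u1 => a b /= ->.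
move/(_ (ball (u : R[i]^o) e%:C)) => [|_ [[x Dx <-]]].
  by apply: nbhsx_ballx; rewrite ltcR.
rewrite -ball_normE /= => h; exists x => //.
by move: h; case: (u - val x) => a b; rewrite ltcR.
Qed.

End Circle.

Lemma Z2_cases (k : 'Z_2) : k = 0 \/ k = 1.
Proof. by case: k => [[|[|k]] hk] //; [left|right]; apply: val_inj. Qed.

(** * Labels on triangles *)

Section Labelling.
Variables (R : realType) (sigma : C3_vertex R -> C3_vertex R -> 'Z_2).
Hypothesis sigma_sym : edge_labelling (@C3c_edge R) sigma.
Hypothesis sigma_aeb : anti_even_balancing (@C3c_edge R) sigma.
Implicit Types x y z w : C3_vertex R.

Lemma C3c_edge_sym x y : C3c_edge x y -> C3c_edge y x.
Proof.
move=> [xy h]; split=> [yx|/C3_edgeE e]; first exact: xy.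
by apply/h/C3_edgeE; rewrite -normcN opprB.
Qed.

Lemma triangle_label x y w : C3c_edge x y -> C3c_edge x w -> C3c_edge y w ->
  sigma x y = sigma x w + sigma y w.
Proof.
move=> xy xw yw.
pose c (k : 'I_3) := if val k is 0 then x else if val k is 1 then y else w.
have cE (k l : 'I_3) : k != l -> C3c_edge (c k) (c l).
  case: k l => [[|[|[|k]]] hk] // [[|[|[|l]]] hl] //= _; rewrite /c //=;
  exact: C3c_edge_sym.
have cI (k l : 'I_3) : C3c_edge (c k) (c l) -> k != l.
  by move=> [h _]; apply/eqP => kl; apply: h; rewrite kl.
(* Any two distinct indices in ['I_3] are cyclically consecutive, so a triangle has no chord to
   exclude. *)
have cyc : induced_cycle (@C3c_edge R) c.
  split=> // [k l kl|k l].
    by apply/eqP; apply: contraT => /cE[/(_ kl)].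
  split=> [/cI|h]; last first.
    apply: cE; case: h => ->; first by case: k => [[|[|[|k]]] hk].
    by case: l => [[|[|[|m]]] hk].
  case: k l => [[|[|[|k]]] hk] // [[|[|[|l]]] hl] //= _;
  by [left; apply: val_inj|right; apply: val_inj].
have := sigma_aeb cyc; rewrite /= !big_ord_recl big_ord0 /c /= addr0.
rewrite (sigma_sym (C3c_edge_sym xw)) => h.
have o2 (k : 'Z_2) : k + k = 0 by case: (Z2_cases k) => ->; apply: val_inj.
rewrite -[RHS]add0r -[X in X + (_ + _)]h -!addrA [sigma x w + (_ + _)]addrA o2.
by rewrite add0r o2 addr0.
Qed.

Definition N1 x y := atom_rel sigma At_N x y \/ atom_rel sigma At_1 x y.

(** Equal bits at [w] rule out label 1 on an edge [x y], by the triangle sum; only [N] remains,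
    which is adjacency in C_3. *)
Lemma N1_label x y w : N1 x y -> C3c_edge x w -> C3c_edge y w ->
  sigma x w = sigma y w -> C3_edge x y.
Proof.
move=> [[xy h] _ _ _|[_ xy s1] xw yw e].
  by apply: contrapT => nxy; apply: h.
have := triangle_label xy xw yw; rewrite s1 e.
by case: (Z2_cases (sigma y w)) => -> /(congr1 val).
Qed.

Lemma N1_triangle x y z w : N1 x y -> N1 y z -> N1 z x ->
  C3c_edge x w -> C3c_edge y w -> C3c_edge z w ->
  sigma x w = sigma y w -> sigma y w = sigma z w -> False.
Proof.
move=> xy yz zx xw yw zw exy eyz.
apply: (@C3_triangle_free _ x y z); apply: N1_label; eauto.
by rewrite exy eyz.
Qed.

End Labelling.

(** * The primitive positive edge relation on 4-tuples *)

Section Formula.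

Definition rel2 X (s : {set atom}) (x y : X) : atomic_formula sig56_65 X :=
  @ARel sig56_65 X s (fun i : 'I_2 => if i == ord0 then x else y).

Let w (s : 'I_2) : 'I_2 * 'I_4 + 'I_3 := inl (s, ord0).
Let x (s : 'I_2) (k : 'I_3) : 'I_2 * 'I_4 + 'I_3 := inl (s, lift ord0 k).
Let z (k : 'I_3) : 'I_2 * 'I_4 + 'I_3 := inr k.

(** As [z k] has bit 1, its triangle with the two [k]-th entries forbids both of these from having
    bit 1. The last two atoms, taken over all [k], close up into a triangle inside each tuple and
    make its bits not all equal. *)
Definition edge_block (k : 'I_3) :=
  [:: rel2 [set At_0; At_1] (x ord0 k) (w ord0);
      rel2 [set At_0; At_1] (x ord_max k) (w ord_max);
      rel2 [set At_1] (z k) (w ord0);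
      rel2 [set At_N; At_1] (x ord0 k) (x ord_max k);
      rel2 [set At_N; At_1] (x ord_max k) (z k);
      rel2 [set At_N; At_1] (z k) (x ord0 k);
      rel2 [set At_N; At_1] (x ord0 k) (x ord0 (ordS k));
      rel2 [set At_N; At_1] (x ord_max k) (x ord_max (ordS k))].

Definition edge_formula : pp_formula sig56_65 ('I_2 * 'I_4) :=
  @PPFormula _ _ 3 (AEq (w ord0) (w ord_max) ::
    flatten [seq edge_block k | k <- enum 'I_3]).

End Formula.

Lemma conj_flatten (I : eqType) (T : Type) (H : T -> Prop) (g : I -> seq T) s :
  foldr (fun a P => H a /\ P) True (flatten [seq g k | k <- s]) <->
  (forall k, k \in s -> foldr (fun a P => H a /\ P) True (g k)).
Proof.
have conj_cat t1 t2 : foldr (fun a P => H a /\ P) True (t1 ++ t2) <->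
    foldr (fun a P => H a /\ P) True t1 /\ foldr (fun a P => H a /\ P) True t2.
  by elim: t1 => /= [|a t1 IH]; tauto.
elim: s => [|i s IH] //=; rewrite conj_cat IH; split=> [[hi hs] k|h].
  by rewrite inE => /orP[/eqP->|/hs].
by split=> [|k ks]; apply: h; rewrite inE ?eqxx ?ks ?orbT.
Qed.

Section Power.
Variables (R : realType) (sigma : C3_vertex R -> C3_vertex R -> 'Z_2).
Local Notation V := (C3_vertex R).
Local Notation N1 := (N1 sigma).

Lemma structB_N1 x y :
  (exists2 a, a \in [set At_N; At_1] & atom_rel sigma a x y) <-> N1 x y.
Proof.
split=> [[a]|[h|h]]; first by rewrite !inE => /orP[]/eqP->; [left|right].
  by exists At_N; rewrite ?inE ?eqxx ?orbT.
by exists At_1; rewrite ?inE ?eqxx ?orbT.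
Qed.

Lemma structB_edge x y :
  (exists2 a, a \in [set At_0; At_1] & atom_rel sigma a x y) <-> C3c_edge x y.
Proof.
split=> [[a]|h]; first by rewrite !inE => /orP[]/eqP-> [].
have [xy _] := h.
case: (Z2_cases (sigma x y)) => e.
  by exists At_0; rewrite ?inE ?eqxx ?orbT.
by exists At_1; rewrite ?inE ?eqxx ?orbT.
Qed.

Lemma structB_1 x y :
  (exists2 a, a \in [set At_1] & atom_rel sigma a x y) <->
  C3c_edge x y /\ sigma x y = 1.
Proof.
split=> [[a]|[h e]]; first by rewrite !inE => /eqP-> [].
by exists At_1; rewrite ?inE ?eqxx ?orbT //; have [xy _] := h.
Qed.

Lemma edge_formulaP (t : 'I_2 -> 'I_4 -> V) :
  let w := t ord0 ord0 in
  let x s k := t s (lift ord0 k) in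
  pp_holds (structB sigma) (fun sm => t sm.1 sm.2) edge_formula <->
  w = t ord_max ord0 /\ exists z : 'I_3 -> V, forall k,
    [/\ [/\ C3c_edge (x ord0 k) w, C3c_edge (x ord_max k) w,
            C3c_edge (z k) w & sigma (z k) w = 1],
        [/\ N1 (x ord0 k) (x ord_max k), N1 (x ord_max k) (z k) &
            N1 (z k) (x ord0 k)],
        N1 (x ord0 k) (x ord0 (ordS k)) &
        N1 (x ord_max k) (x ord_max (ordS k))].
Proof.
move=> w x; split.
  move=> [z /= [ew /conj_flatten h]]; split=> //; exists z => k.
  have /= [/structB_edge h1 [/structB_edge h2 [/structB_1[h3 h3']]]] :=
    h k (mem_enum _ _).
  move=> [/structB_N1 h4 [/structB_N1 h5 [/structB_N1 h6]]].
  move=> [/structB_N1 h7 [/structB_N1 h8 _]].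
  by split=> //; split=> //; rewrite /w ew.
move=> [ew [z h]]; exists z => /=; split=> //; apply/conj_flatten => k _.
have [[h1 h2 h3 h3'] [h4 h5 h6] h7 h8] := h k.
rewrite ew in h2; rewrite /= /structB /= !structB_edge structB_1 !structB_N1.
by split.
Qed.

End Power.

(* The points [pt s k] lie near [i p^0] or [- i p^0] according to [s], with
   [i (pt s k) = k]. Since [p^0] has index 0, it is the tree neighbour of every
   vertex adjacent to it, so [k] is the label of the edge from [pt s k]. *)
Lemma exists_labelled_points (R : realType)
    (C : 'Z_2 -> set (C3_vertex R)) (i : C3_vertex R -> 'Z_2)
    (p : 'I_5 -> C3_vertex R) (sigma : C3_vertex R -> C3_vertex R -> 'Z_2) :
  is_sigma_C3c C i p sigma ->
  exists pt : bool -> 'Z_2 -> C3_vertex R,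
    (forall s k, C3c_edge (pt s k) (p ord0) /\ sigma (pt s k) (p ord0) = k) /\
    (forall s s' k l, (s, k) != (s', l) -> N1 sigma (pt s k) (pt s' l)).
Proof.
move=> [[Ctriv _ Cdense] Ci _ [ssym saeb sT]].
pose q (s : bool) : R[i] := (if s then 'i else - 'i)%C * val (p ord0).
have q1 s : normc (q s) = 1.
  rewrite normcM normc_vertex mulr1.
  by case: s; rewrite /= ?oppr0 ?sqrrN !expr2 mulr0 mulr1 add0r sqrtr1.
(* The radius 1/16 leaves room on both sides of sqrt 3: distances to [p ord0] stay below sqrt 2 +
   1/16, those between opposite points above 2 - 1/8. *)
have near s k := dense_near (Cdense k) (q1 s) (ltac:(lra) : 0 < 1 / 16 :> R).
pose pt s k := sval (cid2 (near s k)).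
have ptC s k : C k (pt s k) by rewrite /pt; case: cid2.
have ptq s k : normc (q s - val (pt s k)) < 1 / 16 by rewrite /pt; case: cid2.
have iE x k : C k x -> i x = k.
  by move=> Ckx; apply: Ctriv => //; exists x; split=> //; apply: Ci.
have ptE s k : C3c_edge (pt s k) (p ord0).
  have qp : normc (q s - val (p ord0)) ^+ 2 = 2.
    rewrite /q -[X in _ - X]mul1r -mulrBl normcM normc_vertex mulr1 normc_sqr.
    by case: s => /=; ring.
  have qp0 := normc_ge0 (q s - val (p ord0)).
  split=> [e|/C3_edgeE].
    by have := ptq s k; rewrite e; nra.
  have := ler_normcD (val (pt s k) - q s) (q s - val (p ord0)).
  rewrite addrA subrK -[X in _ <= X + _ -> _]normcN opprB.
  have := normc_ge0 (val (pt s k) - val (p ord0)).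
  have := normc_ge0 (q s - val (pt s k)); have := ptq s k.
  move: (normc _) (normc _) (normc _) qp qp0 => a b c.
  move=> cc c0 b1 b0 a0 abc a3.
  have : c <= 3 / 2 by nra.
  nra.
have sE s k : sigma (pt s k) (p ord0) = k.
  by rewrite sT; [apply/iE/ptC|split].
exists pt; split=> [s k|s s' k l]; first by [].
(* On one side the two points are distinct but close, hence joined, and their triangle with [p ord0]
   gives the label k + l = 1. Points on opposite sides are almost antipodal, hence [N]-related. *)
have [es|ns] := eqVneq s s'.
  rewrite es xpair_eqE eqxx /= => kl; right.
  have ne : pt s' k <> pt s' l.
    by move=> e; move/eqP: kl; apply; rewrite -(sE s' k) e sE.
  have e : C3c_edge (pt s' k) (pt s' l).
    split=> // /C3_edgeE.
    have := ler_normcD (val (pt s' k) - q s') (q s' - val (pt s' l)).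
    rewrite addrA subrK -[X in _ <= X + _ -> _]normcN opprB.
    have := normc_ge0 (val (pt s' k) - val (pt s' l)).
    have := ptq s' k; have := ptq s' l; nra.
  split=> //; rewrite (triangle_label ssym saeb e (ptE _ _) (ptE _ _)) !sE.
  by case: (Z2_cases k) (Z2_cases l) kl => -> [] -> // _; apply: val_inj.
move=> _; left.
have far : C3_edge (pt s k) (pt s' l).
  apply/C3_edgeE.
  have qq : normc (q s - q s') = 2.
    rewrite /q -mulrBl normcM normc_vertex mulr1.
    apply/eqP; rewrite -(eqrXn2 (n := 2)) ?normc_ge0 // normc_sqr; apply/eqP.
    by case: s s' ns => [] [] //= _; ring.
  have h1 := ler_normcD (q s - val (pt s k)) (val (pt s k) - q s').
  have h2 := ler_normcD (val (pt s k) - val (pt s' l)) (val (pt s' l) - q s').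
  rewrite addrA subrK qq in h1; rewrite addrA subrK in h2.
  rewrite -[X in _ <= _ + X]normcN opprB in h2.
  have := ptq s k; have := ptq s' l; nra.
by split; [move=> e; case: far|move=> [_]].
Qed.

Theorem theorem6p1 (R : realType)
    (C : 'Z_2 -> set (C3_vertex R)) (i : C3_vertex R -> 'Z_2)
    (p : 'I_5 -> C3_vertex R)
    (sigma : C3_vertex R -> C3_vertex R -> 'Z_2)
    (hsigma : is_sigma_C3c C i p sigma) :
  pp_constructs (structB sigma) K3.
Proof.
have [_ _ _ [ssym saeb _]] := hsigma.
exists 4%N, (fun _ t =>
  pp_holds (structB sigma) (fun sm => t sm.1 sm.2) edge_formula).
split.
  split=> // r; exists edge_formula => v.
  by have -> : (fun sm => v (sm.1, sm.2)) = v by apply/funext; case.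
split.
  pose bit (t : 'I_4 -> C3_vertex R) k := sigma (t (lift ord0 k)) (t ord0).
  (* The default [ord0] is harmless: by [colP], a tuple incident to an edge has a bit 1. *)
  pose col t := odflt ord0 [pick k : 'I_3 | bit t k == 1].
  have colP t : (forall k, C3c_edge (t (lift ord0 k)) (t ord0)) ->
      (forall k, N1 sigma (t (lift ord0 k)) (t (lift ord0 (ordS k)))) ->
      bit t (col t) = 1.
    move=> tw tN; rewrite /col; case: pickP => [k /eqP //|no].
    have b0 k : bit t k = 0.
      by case: (Z2_cases (bit t k)) => // e; have := no k; rewrite e eqxx.
    pose k0 : 'I_3 := ord0.
    have S3 : ordS (ordS (ordS k0)) = k0 by apply: val_inj.
    have := tN (ordS (ordS k0)); rewrite S3 => h.
    case: (N1_triangle ssym saeb (tN k0) (tN (ordS k0)) h (tw _) (tw _) (tw _));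
    by rewrite -!/(bit t _) !b0.
  exists col => r t /edge_formulaP[ew [z h]] e.
  have c0 : bit (t ord0) (col (t ord0)) = 1.
    by apply: colP => k; have [[]] := h k.
  have c1 : bit (t ord_max) (col (t ord_max)) = 1.
    by apply: colP => k; rewrite -?ew; have [[]] := h k.
  rewrite -e /bit -ew in c1.
  (* If both tuples had the same colour, their entries there and the matching [z] would form a
     forbidden triangle with all bits 1. *)
  have [[h1 h2 h3 h3'] [h4 h5 h6] _ _] := h (col (t ord0)).
  apply: (N1_triangle ssym saeb h4 h5 h6 h1 h2 h3); rewrite ?c1 ?h3' //.
have [pt [ptw ptN]] := exists_labelled_points hsigma.
(* In each row [j] and each column [k] the two off-diagonal entries, which have
   label 0, lie on opposite sides. *)
pose sk (j k : 'I_3) : bool * 'Z_2 :=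
  if k == j then (true, 1) else (k == ordS j, 0).
pose g (j : 'I_3) (m : 'I_4) :=
  if unlift ord0 m is Some k then pt (sk j k).1 (sk j k).2 else p ord0.
have gw j : g j ord0 = p ord0 by rewrite /g unlift_none.
have gx j k : g j (lift ord0 k) = pt (sk j k).1 (sk j k).2 by rewrite /g liftK.
have gN j k j' k' : sk j k != sk j' k' ->
    N1 sigma (g j (lift ord0 k)) (g j' (lift ord0 k')).
  by move=> h; rewrite !gx; apply: ptN; rewrite -!surjective_pairing.
have sk_row j k : sk j k != sk j (ordS k).
  by case: j k => [[|[|[|j]]] hj] // [[|[|[|k]]] hk].
exists g => r v vv; apply: (proj2 (edge_formulaP sigma (fun s => g (v s)))).
rewrite !gw; split=> //.
(* The table [sk] uses bit 1 only on side [true], so this one point differs from every entry and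
   serves all [k]. *)
exists (fun _ => pt false 1) => k.
have [e0 _] := ptw (sk (v ord0) k).1 (sk (v ord0) k).2.
have [e1 _] := ptw (sk (v ord_max) k).1 (sk (v ord_max) k).2.
have [e2 e2'] := ptw false 1.
have skz j l : sk j l != (false, 1).
  by rewrite /sk; case: ifP => // _; rewrite xpair_eqE andbF.
split; [by rewrite !gx| |exact: gN|exact: gN].
split; last first.
- by rewrite gx; apply: ptN; rewrite -surjective_pairing eq_sym.
- by rewrite gx; apply: ptN; rewrite -surjective_pairing.
(* Distinct rows of [sk] differ in every column; this is checked case by case. *)
apply: gN; move: vv; rewrite /K3 /=.
case: (v ord0) (v ord_max) k {e0 e1} => [[|[|[|j]]] hj] // [[|[|[|j']]] hj'] //;
by [move=> _ []; apply: val_inj|case=> [[|[|[|k]]] hk]].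
Qed.
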